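(* Every graph with minimum degree $\delta\geq 16$ has a $\frac{1}{4}$-majority $5$-edge-colouring.
   Context: Graphs are finite and simple. A $\frac{1}{k}$-majority $l$-edge-colouring of a graph $G$ is an assignment to each edge of $G$ of one of $l$ colours such that for every colour $i$ and every vertex $v$ of $G$, at most $\frac{d_G(v)}{k}$ of the edges incident with $v$ have colour $i$ (where $d_G(v)$ is the degree of $v$). *)

(* Defs.v *)
From mathcomp Require Import all_boot all_order all_algebra.
Set Implicit Arguments.
Unset Strict Implicit.
Unset Printing Implicit Defensive.

Import Order.TTheory GRing.Theory Num.Theory.

(* A finite simple graph on the vertex type T is given by a symmetric and
   irreflexive adjacency relation e : rel T; its edges are the unordered pairs
   of adjacent vertices. *)
Definition edges (T : finType) (e : rel T) : {set {set T}} :=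
  [set E : {set T} | [exists x, exists y, e x y && (E == [set x; y])]].

Definition edge (T : finType) (e : rel T) := {E : {set T} | E \in edges e}.

Definition degree (T : finType) (e : rel T) (v : T) : nat :=
  #|[set w | e v w]|.

Definition colour_degree (T : finType) (e : rel T) (l : nat)
    (c : edge e -> 'I_l) (v : T) (i : 'I_l) : nat :=
  #|[set E : edge e | (v \in val E) && (c E == i)]|.

Definition majority_edge_colouring (k : nat) (T : finType) (e : rel T)
    (l : nat) (c : edge e -> 'I_l) : Prop :=
  forall (i : 'I_l) (v : T),
    ((colour_degree c v i)%:R <= (degree e v)%:R / k%:R :> rat)%R.

(* Main.v *)
Require Import Defs.
From mathcomp Require Import all_boot all_order all_algebra.
From mathcomp Require Import zify.

(* Put f(v) = floor(d(v)/4). Since d(v) >= 16, d(v) < 5 f(v), so it suffices to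
   prove the version of Vizing's theorem with capacities (Hakimi and Kariv): if
   d(v) < K f(v) for all v, the edges can be coloured with K colours, each used
   at most f(v) times at v.

   Edges are added one by one. For an uncoloured edge xy, a Vizing fan at x is
   grown until it reaches a vertex missing a colour that x also misses, or until
   a colour b repeats. In the second case, alternating paths are replaced by a
   parity argument. Let a be missing at x. The graph formed by two colour
   classes and the uncoloured edge can be split evenly in two on the component
   of x, with an imbalance of 2 at a single vertex of our choice, so it can be
   recoloured within capacity unless every degree in the component is 2 f(v).
   If this fails for the classes a, b at the first occurrence of b in the fan,
   that component is even and hence bridgeless, and recolouring works after
   shifting the whole fan. *)

Set Implicit Arguments.
Unset Strict Implicit.
Unset Printing Implicit Defensive.

Import GRing.Theory Num.Theory.

(** * Degrees, balanced splittings and parity *)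

Section Degrees.

Variable T : finType.
Implicit Types (r : rel T) (u v w x y z : T).

Lemma degreeE r v : degree r v = \sum_w r v w.
Proof.
rewrite /degree cardsE -sum1_card big_mkcond; apply: eq_bigr => w _.
by rewrite unfold_in; case: (r v w).
Qed.

Lemma eq_degree r1 r2 v : (forall w, r1 v w = r2 v w) -> degree r1 v = degree r2 v.
Proof. by move=> eq_r; rewrite !degreeE; apply: eq_bigr => w _; rewrite eq_r. Qed.

(** Identities between degrees are reduced to a pointwise check on edges; where fewer than four
    relations occur, the empty relation fills the free place. *)
Lemma degreeD r1 r2 r3 r4 v :
  (forall w, r1 v w + r2 v w = r3 v w + r4 v w) ->
  degree r1 v + degree r2 v = degree r3 v + degree r4 v.
Proof.
by move=> eq_r; rewrite !degreeE -!big_split; apply: eq_bigr => w _; apply: eq_r.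
Qed.

Definition link x y : rel T := fun u v =>
  ((u == x) && (v == y)) || ((u == y) && (v == x)).

Definition del_edge r x y : rel T := fun u v => r u v && ~~ link x y u v.

Lemma link_sym x y : symmetric (link x y).
Proof. by move=> u v; rewrite /link orbC (andbC (u == y)) (andbC (u == x)). Qed.

Lemma linkxx x y : link x y x y.
Proof. by rewrite /link !eqxx. Qed.

Lemma degree_link x y v : x != y -> degree (link x y) v = (v == x) + (v == y).
Proof.
move=> xy; rewrite degreeE.
have ->: \sum_w link x y v w = \sum_w (((v == x) && (w == y)) + ((v == y) && (w == x))).
  apply: eq_bigr => w _; rewrite /link.
  by have [->|//] := eqVneq v x; rewrite (negbTE xy) /= orbF addn0.
have sum_eq b t : \sum_w (b && (w == t)) = b :> nat.
  rewrite (bigD1 t) //= eqxx andbT big1 ?addn0 // => w /negbTE->.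
  by rewrite andbF.
by rewrite big_split /= !sum_eq.
Qed.

Lemma del_edge_sym r x y : symmetric r -> symmetric (del_edge r x y).
Proof. by move=> r_sym u v; rewrite /del_edge r_sym link_sym. Qed.

Lemma link_rel r x y u v : symmetric r -> r x y -> link x y u v -> r u v.
Proof. by move=> r_sym rxy /orP[] /andP[/eqP-> /eqP->] //; rewrite r_sym. Qed.

Lemma degree_del_edge r x y v : symmetric r -> x != y -> r x y ->
  degree r v = degree (del_edge r x y) v + (v == x) + (v == y).
Proof.
move=> r_sym xy rxy; rewrite -addnA -degree_link //.
rewrite -[LHS]addn0 -[in LHS](_ : degree [rel _ _ | false] v = 0).
  apply: degreeD => w; rewrite /del_edge /=.
  case E: (link x y v w); last by rewrite andbT.
  by rewrite (link_rel r_sym rxy E).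
by rewrite degreeE big1.
Qed.

Lemma sum_degree_del_edge r x y : symmetric r -> x != y -> r x y ->
  \sum_v degree (del_edge r x y) v < \sum_v degree r v.
Proof.
move=> r_sym xy rxy; rewrite [X in _ < X](bigD1 x) // [X in X < _](bigD1 x) //=.
rewrite [X in _ < X + _](degree_del_edge _ r_sym xy rxy) eqxx.
rewrite -addSn leq_add //; first by lia.
by apply: leq_sum => v _; rewrite (degree_del_edge _ r_sym xy rxy); lia.
Qed.

(** The vertices reachable from [x] or [y] without the edge form a set closed under [r], since the
    edge itself only joins two of them. *)
Lemma connect_del_edge r x y v : symmetric r -> connect r x v ->
  connect (del_edge r x y) x v || connect (del_edge r x y) y v.
Proof.
move=> r_sym cxv; pose r' := del_edge r x y.
pose A := [pred u | connect r' x u || connect r' y u].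
suff clA: closed r A by have := closed_connect clA cxv; rewrite !inE connect0 => <-.
apply: intro_closed; first exact: sym_connect_sym.
move=> u w ruw; rewrite !inE.
case E: (link x y u w).
  by case/orP: E => /andP[_ /eqP->]; rewrite connect0 ?orbT.
have r'uw : connect r' u w by apply: connect1; rewrite /r' /del_edge ruw E.
by case/orP=> cu; rewrite (connect_trans cu r'uw) ?orbT.
Qed.

(* Each step removes an edge at [z] and moves the exceptional vertex to its
   other end, which then absorbs the removed edge. *)
Lemma balanced_bicolouring r z : symmetric r -> irreflexive r ->
  exists c : rel T, (forall u v, r u v -> c u v = c v u) /\
    forall v, connect r z v ->
      degree [rel u w | r u w && c u w] v
        <= degree [rel u w | r u w && ~~ c u w] v + 1 + (v == z) /\
      degree [rel u w | r u w && ~~ c u w] v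
        <= degree [rel u w | r u w && c u w] v + 1 + (v == z).
Proof.
have [n] := ubnP (\sum_v degree r v).
elim: n => // n IHn in r z *; rewrite ltnS => le_n r_sym r_irr.
case: (pickP (r z)) => [w rzw | rz0]; last first.
  exists [rel _ _ | true]; split=> // v /connectP[[|u p] /=]; last by rewrite rz0.
  move=> _ ->; rewrite eqxx.
  rewrite !degreeE !big1 //= => u _; by rewrite rz0.
have zw : z != w by apply/eqP => E; rewrite E r_irr in rzw.
pose r' := del_edge r z w.
have r'_sym : symmetric r' by apply: del_edge_sym.
have r'_irr : irreflexive r' by move=> u; rewrite /r' /del_edge r_irr.
have lt_n : \sum_v degree r' v < n by apply: leq_trans le_n; apply: sum_degree_del_edge.
have [c1 [c1_sym c1P]] := IHn r' z lt_n r'_sym r'_irr.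
have [c2 [c2_sym c2P]] := IHn r' w lt_n r'_sym r'_irr.
pose pos (c : rel T) v := degree [rel u w | r' u w && c u w] v.
pose neg (c : rel T) v := degree [rel u w | r' u w && ~~ c u w] v.
have extend (c : rel T) s : (forall u v, r' u v -> c u v = c v u) ->
    let c' := [rel u v | if link z w u v then s else c u v] in
    (forall u v, r u v -> c' u v = c' v u) /\
    (forall v, degree [rel u w | r u w && c' u w] v
        = pos c v + s * ((v == z) + (v == w)) /\
      degree [rel u w | r u w && ~~ c' u w] v
        = neg c v + ~~ s * ((v == z) + (v == w))).
  move=> c_sym c'; split.
    move=> u v ruv; rewrite /c' /= (link_sym z w v u); case: ifP => // E.
    by apply: c_sym; rewrite /r' /del_edge ruv E.
  move=> v; rewrite -degree_link //.
  have D0 : degree [rel _ _ | false] v = 0 by rewrite degreeE big1.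
  have D1 (b : bool) (q : rel T) : b * degree q v = degree [rel u w | b && q u w] v.
    by case: b; rewrite ?mul1n ?mul0n //= -[RHS]D0.
  rewrite !D1 -[X in X = _ /\ _]addn0 -[X in _ /\ X = _]addn0 -D0.
  split; apply: degreeD => u; rewrite /r' /del_edge /c' /=;
  case E: (link z w v u); rewrite ?andbT ?andbF ?addn0 //=;
  by rewrite (link_rel r_sym rzw E).
(* If [z] and [w] stay connected, [c2] balances the whole component, up to 2 at [w] only. Giving the
   removed edge a colour not in the majority at [w] repairs [w] and makes the imbalance at [z] at
   most 2. *)
have [czw | nczw] := boolP (connect r' w z).
  pose s := pos c2 w < neg c2 w.
  have [c'_sym c'P] := extend c2 s c2_sym.
  eexists; split; first exact: c'_sym.
  move=> v czv; have [-> ->] := c'P v.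
  have cwv : connect r' w v.
    by case/orP: (connect_del_edge w r_sym czv) => // /(connect_trans czw).
  have := c2P v cwv; rewrite -/(pos c2 v) -/(neg c2 v).
  have [-> |vw] := eqVneq v w.
    by rewrite eq_sym (negbTE zw) /s; case: ltnP => /=; lia.
  by case: (s) => /=; lia.
pose s := pos c2 w < neg c2 w.
(* Otherwise the two sides are coloured independently, by [c2] near [w] and [c1] near [z]. The
   colours of [c1] are swapped when [t] is false, so that the colour [s] of the removed edge is not
   in the majority at [z] either. *)
pose t := s == (pos c1 z < neg c1 z).
pose c0 := [rel u v | if connect r' w u then c2 u v else c1 u v == t].
have c0_sym u v : r' u v -> c0 u v = c0 v u.
  move=> r'uv; rewrite /c0 /=.
  have -> : connect r' w u = connect r' w v.
    apply: (same_connect_r (sym_connect_sym r'_sym)).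
    exact: connect1.
  by rewrite c1_sym // c2_sym.
have [c'_sym c'P] := extend c0 s c0_sym.
eexists; split; first exact: c'_sym.
move=> v czv; have [-> ->] := c'P v.
have [cwv | ncwv] := boolP (connect r' w v).
  have -> : pos c0 v = pos c2 v by apply: eq_degree => u; rewrite /= cwv.
  have -> : neg c0 v = neg c2 v by apply: eq_degree => u; rewrite /= cwv.
  have vz : v == z = false by apply: contraNF nczw => /eqP<-.
  have := c2P v cwv; rewrite -/(pos c2 v) -/(neg c2 v) vz.
  have [-> | vw] := eqVneq v w; last by case: (s) => /=; lia.
  by rewrite /s; case: ltnP => /=; lia.
have c1v : connect r' z v.
  by have := connect_del_edge w r_sym czv; rewrite -/r' (negbTE ncwv) orbF.
have vw : v == w = false by apply: contraNF ncwv => /eqP->.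
have -> : pos c0 v = if t then pos c1 v else neg c1 v.
  case E: t; apply: eq_degree => u; rewrite /= (negbTE ncwv) E; by case: (c1 v u).
have -> : neg c0 v = if t then neg c1 v else pos c1 v.
  case E: t; apply: eq_degree => u; rewrite /= (negbTE ncwv) E; by case: (c1 v u).
have := c1P v c1v; rewrite -/(pos c1 v) -/(neg c1 v) vw.
have [-> | vz] := eqVneq v z; last by case: (t); case: (s) => /=; lia.
by rewrite /t; case: (s); case: ltnP => /=; lia.
Qed.

Lemma even_sum_degree r (A : {pred T}) : symmetric r -> irreflexive r -> closed r A ->
  ~~ odd (\sum_(v in A) degree r v).
Proof.
move=> r_sym r_irr clA.
have -> : \sum_(v in A) degree r v = \sum_(v in A) \sum_(w in A) r v w.
  apply: eq_bigr => v Av; rewrite degreeE [RHS]big_mkcond; apply: eq_bigr => w _.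
  by case E: (r v w); case: ifP => //; rewrite -(clA _ _ E) Av.
(* Handshake argument: ordering the vertices splits the sum into two halves, each counting every
   edge once. *)
pose lt u v := enum_rank u < enum_rank v.
have -> : \sum_(v in A) \sum_(w in A) r v w =
    (\sum_(v in A) \sum_(w in A) (lt v w && r v w)) +
    \sum_(v in A) \sum_(w in A) (lt w v && r v w).
  rewrite -big_split; apply: eq_bigr => v _; rewrite -big_split; apply: eq_bigr => w _.
  rewrite /lt /=; case: ltngtP => [_|_|E] /=; rewrite ?addn0 //.
  by rewrite (enum_rank_inj (val_inj E)) r_irr.
rewrite [X in _ + X]exchange_big /=.
rewrite [X in _ + X](_ : _ = \sum_(v in A) \sum_(w in A) (lt v w && r v w)).
  by rewrite addnn odd_double.
by apply: eq_bigr => v _; apply: eq_bigr => w _; rewrite r_sym.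
Qed.

(** If the edge were a bridge, then after its deletion [x] would be the only vertex of odd degree in
    its component, against the handshake lemma. *)
Lemma even_component_no_bridge r x y : symmetric r -> irreflexive r -> r x y ->
  (forall v, connect r x v -> ~~ odd (degree r v)) -> connect (del_edge r x y) x y.
Proof.
move=> r_sym r_irr rxy ev; apply/negPn/negP => ncxy.
have xy : x != y by apply/eqP => E; rewrite E r_irr in rxy.
pose r' := del_edge r x y.
have r'_sym : symmetric r' by apply: del_edge_sym.
have r'_irr : irreflexive r' by move=> u; rewrite /r' /del_edge r_irr.
have r'r : subrel (connect r') (connect r).
  by apply: connect_sub => u v /andP[ruv _]; apply: connect1.
have clA : closed r' (connect r' x).
  move=> u v r'uv; rewrite !unfold_in.
  by apply: (same_connect_r (sym_connect_sym r'_sym)); apply: connect1.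
have := even_sum_degree r'_sym r'_irr clA.
have Ax : x \in connect r' x by exact: (connect0 r' x).
rewrite (bigD1 x Ax) /= oddD.
have := ev x (connect0 _ _); rewrite (degree_del_edge x r_sym xy rxy) eqxx (negbTE xy).
rewrite addn0 addn1 /= negbK -/r' => ->.
rewrite (_ : odd _ = false) // ; apply/negbTE.
elim/big_rec: _ => // v n /andP[Av vx] on; rewrite oddD (negbTE on) addbF.
have := ev v (r'r _ _ Av); rewrite (degree_del_edge v r_sym xy rxy) (negbTE vx).
have -> : v == y = false by apply: contraNF ncxy => /eqP vy; move: Av; rewrite vy.
by rewrite !addn0.
Qed.

End Degrees.

(** * Edge colourings with vertex capacities *)

Section CapacityColouring.

Variables (T : finType) (K : nat) (f : T -> nat).
Implicit Types (e : rel T) (u v w x y z : T) (a b c : 'I_K).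
Implicit Types (col : T -> T -> option 'I_K).

Definition colour_class col c : rel T := fun u v => col u v == Some c.

Definition missing col v c := degree (colour_class col c) v < f v.

(** Colours live on ordered pairs, with [None] exactly on the non-edges, so that colour classes are
    relations. A partial colouring is a colouring of the graph without the uncoloured edges. *)
Definition capacity_colouring e col :=
  [/\ forall u v, col u v = col v u,
      forall u v, col u v = e u v :> bool
    & forall c v, degree (colour_class col c) v <= f v].

Lemma eq_missing col1 col2 v c :
  (forall u w, colour_class col1 c u w = colour_class col2 c u w) ->
  missing col1 v c = missing col2 v c.
Proof. by move=> E; rewrite /missing (eq_degree (r2 := colour_class col2 c)). Qed.

(** If every colour were full at [v], the disjoint colour classes would give [v] at least [K * f v]
    neighbours. *)
Lemma exists_missing e e' col v : capacity_colouring e' col ->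
  subrel e' e -> degree e v < K * f v -> exists c, missing col v c.
Proof.
case=> _ col_e' _ sub lt_v; apply/existsP; apply: contraLR lt_v => /existsPn full.
rewrite -leqNgt; apply: (@leq_trans (\sum_(c < K) degree (colour_class col c) v)).
  rewrite (_ : K * f v = \sum_(c < K) f v); last by rewrite sum_nat_const card_ord.
  rewrite leq_sum // => c _.
  by rewrite leqNgt; apply: full.
under eq_bigr do rewrite degreeE.
rewrite exchange_big degreeE leq_sum // => w _.
case E: (col v w) => [c|]; last by rewrite big1 // => c _; rewrite /colour_class E.
have -> : e v w by apply: sub; rewrite -col_e' E.
rewrite (bigD1 c) //= big1 => [|c' nc].
  by rewrite addn0 leq_b1.
by rewrite /colour_class E (inj_eq Some_inj) eq_sym (negbTE nc).
Qed.

(** * Colouring one more edge: recolouring two classes and shifting fans *)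

Section UncolouredEdge.

Variables (e : rel T) (e_sym : symmetric e) (e_irr : irreflexive e) (x : T).

Definition bicoloured col a b y : rel T := fun u v =>
  [|| link x y u v, colour_class col a u v | colour_class col b u v].

Lemma uncoloured_link col y u v : capacity_colouring (del_edge e x y) col ->
  link x y u v -> col u v = None.
Proof.
case=> _ col_e _ xy; have := col_e u v; rewrite /del_edge xy andbF.
by case: (col u v).
Qed.

Lemma degree_bicoloured col a b y v : capacity_colouring (del_edge e x y) col ->
  e x y -> a != b ->
  degree (bicoloured col a b y) v =
    degree (colour_class col a) v + degree (colour_class col b) v
    + (v == x) + (v == y).
Proof.
move=> colP exy ab.
have xy : x != y by apply/eqP => E; rewrite E e_irr in exy.
rewrite -[RHS]addnA -degree_link //.
pose r := [rel u v | colour_class col a u v || colour_class col b u v].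
have D0 : degree [rel _ _ | false] v = 0 by rewrite degreeE big1.
have -> : degree (colour_class col a) v + degree (colour_class col b) v = degree r v.
  rewrite -[RHS]addn0 -D0; apply: degreeD => w; rewrite /r /colour_class /= addn0.
  case: eqP => [->|_] //=; rewrite (inj_eq Some_inj) (negbTE ab) //.
rewrite -[LHS]addn0 -D0; apply: degreeD => w; rewrite /bicoloured /r /colour_class /=.
by case E: link; rewrite ?addn0 // (uncoloured_link colP E).
Qed.

(** The new edge is paid for by the slack of [a] at [x] and by that of [b] at [y]. *)
Lemma degree_bicoloured_le col a b y v : capacity_colouring (del_edge e x y) col ->
  e x y -> a != b -> missing col x a -> missing col y b ->
  degree (bicoloured col a b y) v <= 2 * f v.
Proof.
move=> colP exy ab; rewrite /missing degree_bicoloured //.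
have [_ _ col_f] := colP; have := col_f a v; have := col_f b v.
have xy : x != y by apply/eqP => E; rewrite E e_irr in exy.
move: (degree (colour_class col a)) (degree (colour_class col b)) => da db.
have [->|_] := eqVneq v x; first by rewrite (negbTE xy); clear; lia.
by have [->|_] := eqVneq v y; clear; lia.
Qed.

(* The two colour classes together with the new edge are recoloured in a
   balanced way on the component of [x]; the slack at [z] pays for the only
   possible exception. *)
Lemma recolour_bicoloured col a b y z :
  capacity_colouring (del_edge e x y) col -> e x y -> a != b ->
  missing col x a -> missing col y b ->
  connect (bicoloured col a b y) x z ->
  degree (bicoloured col a b y) z < 2 * f z ->
  exists col', capacity_colouring e col'.
Proof.
move=> colP exy ab xa yb; set r := bicoloured col a b y => cxz lt_z.
have [col_sym col_e col_f] := colP.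
have r_sym : symmetric r.
  by move=> u v; rewrite /r /bicoloured /colour_class link_sym (col_sym u v).
have re u v : r u v -> e u v.
  rewrite /r /bicoloured /colour_class => /or3P[/(link_rel e_sym exy)//||] /eqP E.
    by have := col_e u v; rewrite E => /esym/andP[].
  by have := col_e u v; rewrite E => /esym/andP[].
have r_irr : irreflexive r by move=> u; apply: contraFF (e_irr u); apply: re.
have conn_sym := sym_connect_sym r_sym.
have deg_r v : degree r v <= 2 * f v.
  exact: degree_bicoloured_le.
have [c [c_sym cP]] := balanced_bicolouring z r_sym r_irr.
pose C u := connect r z u.
(* Only the component of [z] is recoloured; it contains [x], hence the uncoloured edge. *)
pose col' u v := if r u v && C u then Some (if c u v then a else b) else col u v.
have Cr u v : r u v -> C u = C v.
  by move=> ruv; apply: (same_connect_r conn_sym); apply: connect1.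
have Cx : C x by rewrite /C conn_sym.
have Cl u v : link x y u v -> C u.
  have Cy : C y by rewrite -(@Cr x y) // /r /bicoloured linkxx.
  by case/orP=> /andP[/eqP->].
have in_C d u v : C u -> colour_class col' d u v =
    [|| (d == a) && (r u v && c u v), (d == b) && (r u v && ~~ c u v)
      | [&& d != a, d != b & colour_class col d u v]].
  move=> Cu; rewrite /colour_class /col' Cu andbT.
  case ruv: (r u v) => /=.
    rewrite (inj_eq Some_inj) (fun_if (fun o => o == d)) !(eq_sym _ d).
    case: (c u v); have [->|na] := eqVneq d a; rewrite ?(negbTE ab) //=.
      have [->|nb] //= := eqVneq d b.
      move: ruv; rewrite /r /bicoloured => /or3P[L||] .
      - by rewrite (uncoloured_link colP L).
      - by move/eqP->; rewrite (inj_eq Some_inj) eq_sym (negbTE na).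
      - by move/eqP->; rewrite (inj_eq Some_inj) eq_sym (negbTE nb).
    have [->|nb] //= := eqVneq d b.
    move: ruv; rewrite /r /bicoloured => /or3P[L||] .
    - by rewrite (uncoloured_link colP L).
    - by move/eqP->; rewrite (inj_eq Some_inj) eq_sym (negbTE na).
    - by move/eqP->; rewrite (inj_eq Some_inj) eq_sym (negbTE nb).
  rewrite !andbF /=.
  move/negbT: ruv; rewrite /r /bicoloured /colour_class !negb_or => /and3P[_ na nb].
  have [->|_] := eqVneq d a; first by rewrite (negbTE na).
  by have [->|_] := eqVneq d b; first by rewrite (negbTE nb).
exists col'; split.
- move=> u v; rewrite /col' r_sym; case ruv: (r v u) => /=; last exact: col_sym.
  by rewrite (Cr _ _ ruv) (c_sym _ _ ruv) col_sym.
- move=> u v; rewrite /col'; case: ifP => [/andP[/re-> _] //|].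
  rewrite col_e /del_edge; case L: (link x y u v); last by rewrite andbT.
  by rewrite (Cl _ _ L) /r /bicoloured L.
move=> d v; have [Cv|nCv] := boolP (C v); last first.
  apply: leq_trans (col_f d v); rewrite (eq_degree (r2 := colour_class col d)) //.
  by move=> w; rewrite /colour_class /col' (negbTE nCv) andbF.
have [le1 le2] := cP v Cv.
have sum_r : degree [rel u w | r u w && c u w] v
    + degree [rel u w | r u w && ~~ c u w] v = degree r v.
  have D0 : degree [rel _ _ | false] v = 0 by rewrite degreeE big1.
  rewrite -[RHS]addn0 -D0; apply: degreeD => w /=.
  by case: (r v w); case: (c v w).
(* Two parts with sum at most [2 * f v] and difference at most 1 are both at most [f v]; at [z] the
   difference may be 2, but the sum is smaller by at least 1. *)
have lt_v : v == z -> degree r v < 2 * f v by move/eqP->.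
have le_v := deg_r v.
have [da|na] := eqVneq d a.
  rewrite (eq_degree (r2 := [rel u w | r u w && c u w])).
    by move: lt_v le1 le2 sum_r le_v; case: (v == z) => [/(_ isT)|_]; clear; lia.
  by move=> w; rewrite in_C //= da eqxx (negbTE ab) /= orbF.
have [db|nb] := eqVneq d b.
  rewrite (eq_degree (r2 := [rel u w | r u w && ~~ c u w])).
    by move: lt_v le1 le2 sum_r le_v; case: (v == z) => [/(_ isT)|_]; clear; lia.
  by move=> w; rewrite in_C //= -db (negbTE na) eqxx /= orbF.
rewrite (eq_degree (r2 := colour_class col d)) //.
by move=> w; rewrite in_C // (negbTE na) (negbTE nb).
Qed.

Lemma colour_common_missing col y c :
  capacity_colouring (del_edge e x y) col -> e x y ->
  missing col x c -> missing col y c -> exists col', capacity_colouring e col'.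
Proof.
move=> colP exy xc yc; have [col_sym col_e col_f] := colP.
have xy : x != y by apply/eqP => E; rewrite E e_irr in exy.
exists (fun u v => if link x y u v then Some c else col u v); split.
- by move=> u v; rewrite link_sym col_sym.
- move=> u v; case: ifP => [/(link_rel e_sym exy)-> //|L].
  by rewrite col_e /del_edge L andbT.
move=> d v.
have [->|nd] := eqVneq d c.
  set D := degree _ v.
  have D0 : degree [rel _ _ | false] v = 0 by rewrite degreeE big1.
  have -> : D = degree (colour_class col c) v + degree (link x y) v.
    rewrite -[LHS]addn0 -D0; apply: degreeD => w; rewrite /colour_class /= addn0.
    by case: ifP => [L|_]; rewrite ?addn0 // (uncoloured_link colP L) eqxx.
  rewrite degree_link //; move: xc yc; rewrite /missing; have := col_f c v.
  have [->|_] := eqVneq v x; first by rewrite (negbTE xy); clear; lia.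
  by have [->|_] := eqVneq v y; clear; lia.
rewrite (eq_degree (r2 := colour_class col d)) // => w; rewrite /colour_class.
case: ifP => [L|//]; rewrite (uncoloured_link colP L) (inj_eq Some_inj) eq_sym.
exact: negbTE.
Qed.

(* A Vizing fan at [x] starting from the uncoloured edge [x y]: the colour of
   each edge of the fan is missing at the preceding end. *)
Fixpoint fan col y (s : seq ('I_K * T)) : bool :=
  if s is (b, y') :: s' then
    [&& missing col y b, col x y' == Some b & fan col y' s']
  else true.

(** The colour [b] moves from [x y'] to [x y]: the degree of [x] in it is unchanged, and only [y],
    where [b] is missing, gains an edge. A fan at [y'] avoiding [b] survives, as its edges keep
    their colours and its vertices differ from [y]. *)
Lemma shift_edge col y y' b : capacity_colouring (del_edge e x y) col ->
  e x y -> missing col y b -> col x y' = Some b ->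
  exists col', [/\ capacity_colouring (del_edge e x y') col',
    forall v c, v != y ->
      degree (colour_class col' c) v <= degree (colour_class col c) v,
    forall s, b \notin unzip1 s -> fan col y' s -> fan col' y' s,
    forall c, c != b -> forall u v, colour_class col' c u v = colour_class col c u v
  & forall u v, colour_class col' b u v
      = link x y u v || (colour_class col b u v && ~~ link x y' u v)].
Proof.
move=> colP exy yb xy'b; have [col_sym col_e col_f] := colP.
have exy' : e x y' by have := col_e x y'; rewrite xy'b => /esym/andP[].
have xy : x != y by apply/eqP => E; rewrite E e_irr in exy.
have xy' : x != y' by apply/eqP => E; rewrite E e_irr in exy'.
have yy' : y != y'.
  by apply/eqP => E; have := uncoloured_link colP (linkxx x y); rewrite E xy'b.
have disj u v : link x y u v -> link x y' u v = false.
  apply: contraTF => /orP[] /andP[/eqP-> /eqP->]; rewrite /link !eqxx.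
    by rewrite (negbTE xy) /= orbF eq_sym.
  by rewrite (negbTE xy) andbF eq_sym (negbTE yy').
have link_b u v : link x y' u v -> col u v = Some b.
  by case/orP=> /andP[/eqP-> /eqP->] //; rewrite col_sym.
pose col' u v := if link x y u v then Some b else
  if link x y' u v then None else col u v.
have class_b u v : colour_class col' b u v
      = link x y u v || (colour_class col b u v && ~~ link x y' u v).
  rewrite /colour_class /col'; case: ifP => [_|_]; first by rewrite eqxx.
  by case: ifP => [_|_]; rewrite ?andbF ?andbT.
have class_o c : c != b ->
    forall u v, colour_class col' c u v = colour_class col c u v.
  move=> cb u v; rewrite /colour_class /col'.
  case: ifP => [L|_].
    by rewrite (uncoloured_link colP L) (inj_eq Some_inj) (eq_sym b) (negbTE cb).
  by case: ifP => [L|//]; rewrite link_b // (inj_eq Some_inj) (eq_sym b) (negbTE cb).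
have deg_b v : degree (colour_class col' b) v + (v == y')
    = degree (colour_class col b) v + (v == y).
  (* Adding the contribution of the common end [x] to both sides turns the indicators into degrees
     of the two links. *)
  apply/eqP; rewrite -(eqn_add2r (v == x)) -!addnA ![(v == _) + (v == x)]addnC.
  rewrite -!degree_link //; apply/eqP; apply: degreeD => w; rewrite class_b.
  case L: (link x y v w).
    by rewrite disj //= /colour_class (uncoloured_link colP L).
  case L': (link x y' v w); rewrite ?andbT ?andbF //=.
  by rewrite /colour_class link_b // eqxx.
have deg_le v c : v != y ->
    degree (colour_class col' c) v <= degree (colour_class col c) v.
  move=> vy; have [->|cb] := eqVneq c b; last by rewrite (eq_degree (class_o c cb v)).
  by have := deg_b v; rewrite (negbTE vy); clear; lia.
exists col'; split=> //.
- split.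
  + by move=> u v; rewrite /col' !(link_sym _ _ v u) col_sym.
  + move=> u v; rewrite /col' /del_edge.
    case: ifP => [L|L]; first by rewrite (link_rel e_sym exy L) disj.
    by case: ifP => [_|_]; rewrite ?andbF // col_e /del_edge L !andbT.
  move=> c v; have [->|cb] := eqVneq c b; last first.
    by rewrite (eq_degree (class_o c cb v)).
  have := deg_b v; have := col_f b v; move: yb; rewrite /missing.
  by have [->|_] := eqVneq v y; clear; lia.
move=> s; have y_neq t c : col x t = Some c -> t != y.
  by apply: contra_eqN => /eqP->; rewrite (uncoloured_link colP (linkxx x y)).
have := y_neq _ _ xy'b; move: {1 2 3}y' => t.
elim: s t => //= -[c t1] s IH t ty.
rewrite inE negb_or => /andP[bc bs] /and3P[miss /eqP xt1 fan1]; apply/and3P; split.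
- exact: leq_ltn_trans (deg_le _ _ ty) miss.
- rewrite -xt1 /col' /link eqxx /= (negbTE (y_neq _ _ xt1)) (negbTE xy) /=.
  suff -> : t1 == y' = false by rewrite (negbTE xy') /= eqxx.
  apply: contraNF bc => /eqP E; apply/eqP/Some_inj.
  by rewrite -xy'b -xt1 E.
- exact: IH (y_neq _ _ xt1) bs fan1.
Qed.

(** Iterates [shift_edge] along [s1]; distinctness of the colours keeps the rest of the fan valid
    after each shift. *)
Lemma shift_fan col y s1 s2 : capacity_colouring (del_edge e x y) col ->
  e x y -> fan col y (s1 ++ s2) -> uniq (unzip1 (s1 ++ s2)) ->
  let y' := last y (unzip2 s1) in
  e x y' /\ exists col', [/\ capacity_colouring (del_edge e x y') col',
    fan col' y' s2
  & forall c, c \notin unzip1 s1 ->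
      forall u v, colour_class col' c u v = colour_class col c u v].
Proof.
elim: s1 col y => [|[b t] s1 IHs] col y /= colP exy.
  by move=> fan2 _; split=> //; exists col.
case/and3P=> yb /eqP xt fan_t /andP[b_notin s_uniq].
have [col1 [col1P _ fan1 class1 _]] := shift_edge colP exy yb xt.
have ext : e x t.
  by have [_ col_e _] := colP; have := col_e x t; rewrite xt => /esym/andP[].
have := IHs col1 t col1P ext (fan1 _ b_notin fan_t) s_uniq.
case=> ext' [col' [col'P fan' class']]; split=> //; exists col'; split=> //.
move=> c; rewrite inE negb_or => /andP[cb cs] u v.
by rewrite class' // class1.
Qed.

(* If [x y] cannot be coloured by rebalancing the classes of [a] and [b], the
   component of [x] in these classes and [x y] is even, hence [x y1] is not a
   bridge of it. Shifting the whole fan then removes [x y1] from it, and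
   leaves slack at [y1], which is still connected to [x]. *)
Lemma cyclic_fan_colouring col y a b y1 s :
  capacity_colouring (del_edge e x y) col -> e x y ->
  fan col y ((b, y1) :: s) -> uniq (a :: b :: unzip1 s) ->
  missing col x a -> missing col (last y1 (unzip2 s)) b ->
  exists col', capacity_colouring e col'.
Proof.
move=> colP exy fan_y; rewrite [uniq _]/= inE negb_or => /andP[/andP[ab a_s] bs_uniq].
move=> xa lb; pose r := bicoloured col a b y.
have /and3P[yb /eqP xy1 fan_y1] := fan_y.
have [col_sym col_e col_f] := colP.
have [/existsP[z /andP[cz lt_z]] | /existsPn full] :=
    boolP [exists z, connect r x z && (degree r z < 2 * f z)].
  exact: recolour_bicoloured colP exy ab xa yb cz lt_z.
have xy : x != y by apply/eqP => E; rewrite E e_irr in exy.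
have exy1 : e x y1 by have := col_e x y1; rewrite xy1 => /esym/andP[].
have x_y1 : x != y1 by apply/eqP => E; rewrite E e_irr in exy1.
have y1y : y1 != y.
  by apply/eqP => E; have := uncoloured_link colP (linkxx x y); rewrite -E xy1.
have deg_r v : connect r x v -> degree r v = 2 * f v.
  move=> cv; have := full v; rewrite cv /= -leqNgt => ge_v; apply/eqP.
  by rewrite eqn_leq ge_v andbT degree_bicoloured_le.
have r_sym : symmetric r.
  by move=> u v; rewrite /r /bicoloured /colour_class link_sym (col_sym u v).
have r_irr : irreflexive r.
  move=> u; have := col_e u u; rewrite /del_edge e_irr /r /bicoloured /colour_class.
  case: (col u u) => // _; rewrite !orbF.
  by apply: contraFF (e_irr u); apply: link_rel.
have rxy1 : r x y1 by rewrite /r /bicoloured /colour_class xy1 eqxx !orbT.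
have conn : connect (del_edge r x y1) x y1.
  apply: even_component_no_bridge => // v cv.
  by rewrite deg_r // mul2n odd_double.
have deg_y1 := deg_r _ (connect1 rxy1).
have /andP[b_s s_uniq] := bs_uniq.
(* The first shift is done apart, being the only one to change the class of [b]; none of the shifts
   changes that of [a]. *)
have [col1 [col1P deg1 fan1 class1 class1b]] := shift_edge colP exy yb xy1.
have := @shift_fan col1 y1 s [::] col1P exy1; rewrite cats0.
set l := last _ _ => /(_ (fan1 _ b_s fan_y1) s_uniq) [exl [col2 [col2P _ class2]]].
have class2b := class2 _ b_s.
have class2a u v : colour_class col2 a u v = colour_class col a u v.
  by rewrite class2 // class1.
(* The edge [x y] now has colour [b], while [x l] is uncoloured. *)
have ly : l != y.
  apply: contraTneq (linkxx x y) => ly.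
  have := class2b x y; rewrite class1b /colour_class.
  by rewrite -ly (uncoloured_link col2P (linkxx x l)); case: link.
have xa2 : missing col2 x a by rewrite (eq_missing _ class2a).
have lb2 : missing col2 l b.
  by rewrite (eq_missing _ class2b); apply: leq_ltn_trans (deg1 _ _ ly) lb.
have bic2 u v : bicoloured col2 a b l u v = link x l u v || del_edge r x y1 u v.
  rewrite /bicoloured class2a class2b class1b /del_edge /r /bicoloured.
  case: (link x l u v) => //=; case L1: (link x y1 u v); last first.
    by rewrite !andbT orbCA.
  have -> : colour_class col a u v = false.
    rewrite /colour_class; case/orP: L1 => /andP[/eqP-> /eqP->].
      by rewrite xy1 (inj_eq Some_inj) eq_sym (negbTE ab).
    by rewrite col_sym xy1 (inj_eq Some_inj) eq_sym (negbTE ab).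
  rewrite !andbF !orbF /=; apply: contraTF L1 => /orP[] /andP[/eqP-> /eqP->].
    by rewrite /link eqxx (negbTE x_y1) orbF eq_sym.
  by rewrite /link (negbTE x_y1) andbF eqxx andbT eq_sym.
apply: (recolour_bicoloured col2P exl ab xa2 lb2 (z := y1)).
  apply: connect_sub conn => u v ruv; apply: connect1.
  by rewrite bic2 ruv orbT.
(* Were [l] equal to [y1], the slack of [b] there would contradict the degree [2 * f y1] in [r].
   Hence the new edge [x l] does not restore the degree lost at [y1]. *)
have ll : l != y1.
  apply/eqP => E; move: deg_y1 lb; rewrite /r degree_bicoloured // -/l E /missing.
  rewrite (negbTE y1y) eq_sym (negbTE x_y1); have := col_f a y1; clear; lia.
rewrite (eq_degree (r2 := del_edge r x y1)).
  by rewrite -deg_y1 (degree_del_edge y1 r_sym x_y1 rxy1) eqxx; clear; lia.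
move=> w; rewrite bic2 /link eq_sym (negbTE x_y1) /= eq_sym.
by rewrite (negbTE ll).
Qed.

(** Induction on [K - size s], which bounds the growth of a fan with distinct colours. As the
    colours of the fan are full at [x], they differ from [a]. *)
Lemma extend_fan_colouring col y s a :
  (forall v, degree e v < K * f v) ->
  capacity_colouring (del_edge e x y) col -> e x y ->
  fan col y s -> uniq (unzip1 s) -> all (fun c => ~~ missing col x c) (unzip1 s) ->
  missing col x a -> exists col', capacity_colouring e col'.
Proof.
move=> deg_e colP exy; have [n] := ubnP (K - size s).
elim: n => // n IHn in s *; rewrite ltnS => le_n fan_s s_uniq s_full xa.
have sub_e : subrel (del_edge e x y) e by move=> u v /andP[].
set l := last y (unzip2 s).
have [b lb] := exists_missing colP sub_e (deg_e l).
have [xb | xb] := boolP (missing col x b).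
  have b_s : b \notin unzip1 s by apply: contraL xb => /(allP s_full).
  have [] := @shift_fan col y s [::] colP exy; rewrite ?cats0 //.
  move=> exl [col' [col'P _ class']].
  apply: (colour_common_missing col'P exl (c := b)).
    by rewrite (eq_missing _ (class' _ b_s)).
  by rewrite (eq_missing _ (class' _ b_s)).
have [b_s | b_s] := boolP (b \in unzip1 s); last first.
  (* The colour [b] is full at [x] and [f x] is positive by the degree bound, so some edge at [x]
     has colour [b] and extends the fan. *)
  have [t xt] : exists t, col x t = Some b.
    have : 0 < degree (colour_class col b) x.
      move: xb; rewrite /missing -leqNgt; apply: leq_trans.
      by have := deg_e x; case: (f x) => //; rewrite muln0.
    by case/card_gt0P=> t; rewrite inE => /eqP; exists t.
  have fan_rcons z : last z (unzip2 s) = l -> fan col z s ->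
      fan col z (rcons s (b, t)).
    elim: (s) z => [|[c u] s' IH] z /=; first by move=> ->; rewrite lb xt eqxx.
    by move=> El /and3P[-> -> /(IH _ El)->].
  have uniq_rcons : uniq (unzip1 (rcons s (b, t))).
    by rewrite /unzip1 map_rcons rcons_uniq b_s.
  apply: (IHn (rcons s (b, t))) => //.
  - have := max_card (mem (unzip1 (rcons s (b, t)))).
    rewrite (card_uniqP uniq_rcons) card_ord size_map size_rcons; move: le_n; clear; lia.
  - exact: fan_rcons.
  - by rewrite /unzip1 map_rcons all_rcons xb.
(* The colour [b] repeats: shifting the part of the fan before its occurrence leaves a fan that
   starts with [b] and whose last vertex misses [b]. *)
have [[b' y1] s_b Eb] := mapP b_s; rewrite /= in Eb; subst b'.
case/splitPr: s_b => s1 s2 in l fan_s s_uniq s_full lb *.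
have s_uniq' := s_uniq; rewrite /unzip1 map_cat cat_uniq /= in s_uniq'.
case/and3P: s_uniq' => _ /norP[b_s1 _] bs_uniq.
have a_s : a \notin unzip1 (s1 ++ (b, y1) :: s2) by apply: contraL xa => /(allP s_full).
move: a_s; rewrite /unzip1 map_cat mem_cat negb_or => /andP[a_s1 a_s2].
have [ext [col1 [col1P fan1 class1]]] := shift_fan colP exy fan_s s_uniq.
apply: (cyclic_fan_colouring col1P ext fan1 (a := a)).
- by rewrite cons_uniq a_s2.
- by rewrite (eq_missing _ (class1 _ a_s1)).
by rewrite (eq_missing _ (class1 _ b_s1)) /l /unzip2 map_cat last_cat /= in lb *.
Qed.

End UncolouredEdge.

(** * Vizing's theorem with capacities *)

Theorem capacity_colouring_exists e : symmetric e -> irreflexive e ->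
  (forall v, degree e v < K * f v) -> exists col, capacity_colouring e col.
Proof.
have [n] := ubnP (\sum_v degree e v).
elim: n => // n IHn in e *; rewrite ltnS => le_n e_sym e_irr deg_e.
have [/existsP[x /existsP[y exy]] | /existsPn e0] := boolP [exists x, exists y, e x y].
  have xy : x != y by apply/eqP => E; rewrite E e_irr in exy.
  have [||||col colP] := IHn (del_edge e x y).
  - exact: leq_trans (sum_degree_del_edge e_sym xy exy) le_n.
  - exact: del_edge_sym.
  - by move=> u; rewrite /del_edge e_irr.
  - move=> v; apply: leq_ltn_trans (deg_e v).
    by rewrite (degree_del_edge v e_sym xy exy); clear; lia.
  have sub_e : subrel (del_edge e x y) e by move=> u v /andP[].
  have [a xa] := exists_missing colP sub_e (deg_e x).
  exact: (extend_fan_colouring e_sym e_irr deg_e colP exy (s := [::]) _ _ _ xa).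
exists (fun _ _ => None); split=> //.
  by move=> u v; apply/esym/negbTE; have /existsPn/(_ v) := e0 u.
by move=> c v; rewrite degreeE big1.
Qed.

End CapacityColouring.

(** * From capacities to majority colourings *)

Theorem theorem16 (T : finType) (e : rel T)
    (e_sym : symmetric e) (e_irr : irreflexive e)
    (min_degree_ge16 : forall v : T, 16 <= degree e v) :
  exists c : edge e -> 'I_5, majority_edge_colouring 4 c.
Proof.
(* The quotient is at least 4, while the remainder modulo 4 is at most 3. *)
have deg_e v : degree e v < 5 * (degree e v %/ 4).
  by have := min_degree_ge16 v; clear; lia.
have [col [col_sym col_e col_f]] := capacity_colouring_exists e_sym e_irr deg_e.
have ends (E : edge e) : {p : T * T | e p.1 p.2 & val E = [set p.1; p.2]}.
  have := valP E; rewrite inE => /existsP exE.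
  pose P (p : T * T) := e p.1 p.2 && (val E == [set p.1; p.2]).
  have /sigW[p /andP[ep /eqP Ep]] : exists p, P p.
    by have [x /existsP[y xy]] := exE; exists (x, y).
  by exists p.
(* The default [ord0] is never reached, since [col] is defined on all edges; by symmetry the order
   of the chosen ends is immaterial. *)
pose c E := let: exist2 p _ _ := ends E in odflt ord0 (col p.1 p.2).
exists c => i v.
rewrite ler_pdivlMr ?ltr0n // -natrM ler_nat.
suff le_f : colour_degree c v i <= degree e v %/ 4.
  by rewrite -leq_divRL.
apply: leq_trans (col_f i v).
(* The edges at [v] of colour [i] are among the sets [[set v; w]] with [w] a neighbour of [v] in
   that colour class. *)
rewrite /colour_degree -(card_imset _ val_inj).
apply: leq_trans (leq_imset_card (fun w => [set v; w]) _).
apply: subset_leq_card; apply/subsetP => A /imsetP[E + ->]; rewrite inE /c.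
case: (ends E) => -[x y] /= exy -> /andP[vE cE].
have col_xy : col x y = Some i.
  by have := col_e x y; rewrite exy; case: (col x y) cE => //= j /eqP->.
move: vE; rewrite !inE => /orP[] /eqP->.
  by apply/imsetP; exists y; rewrite // inE /colour_class col_xy.
by apply/imsetP; exists x; [rewrite inE /colour_class col_sym col_xy | rewrite setUC].
Qed.
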